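(* Suppose $\bar V\le 0$. Consider the platform's problem when all users choose the high level of data sharing: $$\begin{aligned}\max_{I,p_0,p_1}\;& U(k,0)-B(I)F-I-p_1k-S\\ \text{s.t. }& p_1-\mathcal V\ge p_0-\alpha\mathcal V,\quad p_1-\mathcal V\ge 0,\quad I,p_0,p_1\ge 0,\end{aligned}$$ where $\mathcal V=\bar V+B(I)L$. Then optimal choices $(I^*,p_1^*,p_0^* )$ of the platform are as follows. 1. If $I_1$ and $I_3$ exist: $(I^*=I_1,\ p_1^*=\bar V+B(I_1)L,\ p_0^*=0)$ when $L\ge\frac{-\bar V}{B(I_1)}$; $(I^*=I_2,\ p_1^*=0,\ p_0^*=0)$ when $\frac{-\bar V}{B(I_1)}\ge L\ge\frac{-\bar V}{B(I_3)}$; and $(I^*=I_3,\ p_1^*=0,\ p_0^*=0)$ when $\frac{-\bar V}{B(I_3)}\ge L$. 2. If $I_1$ exists but $I_3$ does not: $(I^*=I_1,\ p_1^*=\bar V+B(I_1)L,\ p_0^*=0)$ when $L\ge\frac{-\bar V}{B(I_1)}$; $(I^*=I_2,\ p_1^*=0,\ p_0^*=0)$ when $\frac{-\bar V}{B(I_1)}\ge L\ge\frac{-\bar V}{B(0)}$; and $(I^*=0,\ p_1^*=0,\ p_0^*=0)$ when $\frac{-\bar V}{B(0)}\ge L$. 3. If neither $I_1$ nor $I_3$ exists: $(I^*=0,\ p_1^*=\bar V+B(0)L,\ p_0^*=0)$ when $L\ge\frac{-\bar V}{B(0)}$; and $(I^*=0,\ p_1^*=0,\ p_0^*=0)$ when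 $\frac{-\bar V}{B(0)}\ge L$.
   Context: An online platform with $k\ge 1$ homogeneous users ($k$ an integer) chooses an investment $I\ge 0$ in data protection and data dividends $p_0,p_1\ge 0$ paid to each user for the low and high level of data sharing respectively. $B:[0,\infty)\to\mathbb{R}$ is twice differentiable with $B(I)>0$, $B'(I)<0$, $B''(I)>0$ for all $I$, and $\lim_{I\to\infty}B(I)=0$ ($B(I)$ is the probability of a data breach). $F>0$ is the platform's loss and $L>0$ each user's loss from a data breach; $S\in\mathbb{R}$ is a fixed cost; $U(k,b)\in\mathbb{R}$ is the platform's revenue when $b$ of the $k$ users choose the low level (so $U(k,0)$ is a constant here); $\alpha\in(0,1)$; $\bar V=V-W\in\mathbb{R}$, where $V$ is the value of a user's data and $W$ the value of the platform's free services. A user's expected utility is $p_1-\mathcal V$ at the high level and $p_0-\alpha\mathcal V$ at the low level, with $\mathcal V=\bar V+B(I)L$; the constraints of the problem say that the high level is utility-maximizing and gives nonnegative utility. Notation: $F_1=F+Lk$, $F_0=F$. $I_1=(B')^{-1}\left(-\frac1{F_1}\right)$ is the unique $I\ge0$ with $B'(I)=-1/F_1$; $I_3=(B')^{-1}\left(-\frac1{F_0}\right)$ is the unique $I\ge 0$ with $B'(I)=-1/F_0$; $I_2=B^{-1}\left(-\frac{\bar V}{L}\right)$ is the unique $I\ge0$ with $B(I)=-\bar V/L$. ''Exists'' means that such a point in $[0,\infty)$ exists. ''Optimal choices'' means that the stated triple is an optimal solution (maximizer) of the problem. *)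

(* Defs.v *)
From Stdlib Require Import Reals.
From Coquelicot Require Import Coquelicot.
Open Scope R_scope.

(* Expected privacy loss of a user's data when Vb is the value of the data net
   of the value of the free services. *)
Definition data_loss (B : R -> R) (L Vb I : R) : R := Vb + B I * L.

Definition utility_high (B : R -> R) (L Vb I p1 : R) : R :=
  p1 - data_loss B L Vb I.

Definition utility_low (B : R -> R) (L alpha Vb I p0 : R) : R :=
  p0 - alpha * data_loss B L Vb I.

(* The second argument of U is the number of users at the low level, which is
   0 here since all k users choose the high level. *)
Definition profit (k : nat) (B : R -> R) (F Sc : R) (U : nat -> nat -> R)
    (I p1 : R) : R :=
  U k 0%nat - B I * F - I - p1 * INR k - Sc.

Definition feasible (B : R -> R) (L alpha Vb I p1 p0 : R) : Prop :=
  utility_high B L Vb I p1 >= utility_low B L alpha Vb I p0 /\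
  utility_high B L Vb I p1 >= 0 /\
  0 <= I /\ 0 <= p0 /\ 0 <= p1.

Definition optimal (k : nat) (B : R -> R) (F L Sc alpha Vb : R)
    (U : nat -> nat -> R) (I p1 p0 : R) : Prop :=
  feasible B L alpha Vb I p1 p0 /\
  forall J q1 q0 : R, feasible B L alpha Vb J q1 q0 ->
    profit k B F Sc U J q1 <= profit k B F Sc U I p1.

(* x is a value of the inverse at y of the restriction of f to [0, +oo);
   "f^-1(y) exists" is  exists x, preimage f y x. *)
Definition preimage (f : R -> R) (y x : R) : Prop := 0 <= x /\ f x = y.

(* Main.v *)
(** The least payment making the high level acceptable at investment [I] is
    [max 0 (data_loss I)], so the platform minimizes the maximum of the two convex
    costs [F * B I + I] and [(F + L k) * B I + I + k Vb] over [I >= 0].  The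
    minimizer is the unconstrained minimizer [I1] of the larger-slope cost while the
    data loss is nonnegative there, the unconstrained minimizer [I3] of the other
    cost once the data loss is nonpositive there, and otherwise the kink [I2].  If a
    stationary point fails to exist, the derivative of that cost is positive at 0
    (it cannot stay negative, because [B] is positive) and 0 is its minimizer. *)
Require Import Defs.
From Stdlib Require Import Reals Lra.
From Coquelicot Require Import Coquelicot.
Open Scope R_scope.

(* Freezing [f] to the left of 0 turns one-sided continuity at 0 into the
   two-sided continuity that the mean and intermediate value theorems require. *)
Definition clamp (f : R -> R) (x : R) : R := f (Rmax 0 x).

Lemma clamp_nonneg (f : R -> R) (x : R) : 0 <= x -> clamp f x = f x.
Proof. intros Hx; unfold clamp; rewrite Rmax_right; auto. Qed.

Lemma Rmax0_dist (x y : R) : Rabs (Rmax 0 y - Rmax 0 x) <= Rabs (y - x).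
Proof.
unfold Rmax; destruct (Rle_dec 0 x), (Rle_dec 0 y);
  unfold Rabs; repeat destruct (Rcase_abs _); lra.
Qed.

Lemma clamp_continuity (f df : R -> R) :
  (forall x, 0 <= x -> D_in f df (Rle 0) x) -> continuity (clamp f).
Proof.
intros Hf x eps Heps.
destruct (cont_deriv f df (Rle 0) (Rmax 0 x) (Hf _ (Rmax_l 0 x)) eps Heps)
  as [d [Hd Hclose]].
exists d; split; [exact Hd|].
intros y [_ Hyx]; simpl in *; unfold clamp.
(* The limit given by [cont_deriv] excludes the base point, yet distinct points left of 0 clamp to
   the same value. *)
destruct (Req_dec (Rmax 0 y) (Rmax 0 x)) as [E|E].
- rewrite E; unfold Rdist; rewrite Rminus_diag, Rabs_R0; exact Heps.
- apply Hclose; split.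
  + split; [apply Rmax_l | intro K; apply E; symmetry; exact K].
  + apply Rle_lt_trans with (2 := Hyx); apply Rmax0_dist.
Qed.

Lemma clamp_derive (f df : R -> R) (x : R) :
  D_in f df (Rle 0) x -> 0 < x -> is_derive (clamp f) x (df x).
Proof.
intros Hf Hx; apply is_derive_Reals; intros eps Heps.
destruct (Hf eps Heps) as [d [Hd Hlim]].
(* An increment shorter than [x] keeps [x + h] in the half-line, where [clamp f] and [f] agree. *)
assert (Hm : 0 < Rmin d x) by (apply Rmin_pos; auto).
exists (mkposreal _ Hm); intros h Hh Hhd; simpl in *.
assert (Hhd' : Rabs h < d) by (apply Rlt_le_trans with (1 := Hhd); apply Rmin_l).
assert (Hhx : Rabs h < x) by (apply Rlt_le_trans with (1 := Hhd); apply Rmin_r).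
apply Rabs_def2 in Hhx.
rewrite !clamp_nonneg by lra.
specialize (Hlim (x + h)); unfold Rdist in Hlim.
replace (x + h - x) with h in Hlim by ring.
apply Hlim; repeat split; auto; lra.
Qed.

Lemma half_line_mvt (f df : R -> R) (a b : R) :
  (forall x, 0 <= x -> D_in f df (Rle 0) x) -> 0 <= a -> 0 <= b ->
  exists c, Rmin a b <= c <= Rmax a b /\ f b - f a = df c * (b - a).
Proof.
intros Hf Ha Hb.
assert (Hmin : 0 <= Rmin a b) by (apply Rmin_glb; auto).
destruct (MVT_gen (clamp f) a b df) as [c [Hc E]].
- intros x Hx; apply clamp_derive; [apply Hf|]; lra.
- intros x _; apply (clamp_continuity f df Hf).
- exists c; split; [exact Hc|].
  rewrite !clamp_nonneg in E; auto.
Qed.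

Lemma half_line_ivt (f df : R -> R) (a b y : R) :
  (forall x, 0 <= x -> D_in f df (Rle 0) x) -> 0 <= a -> 0 <= b ->
  Rmin (f a) (f b) <= y <= Rmax (f a) (f b) ->
  exists c, Rmin a b <= c <= Rmax a b /\ f c = y.
Proof.
intros Hf Ha Hb Hy.
assert (Hmin : 0 <= Rmin a b) by (apply Rmin_glb; auto).
destruct (IVT_gen (clamp f) a b y) as [c [Hc E]].
- exact (clamp_continuity f df Hf).
- rewrite !clamp_nonneg; auto.
- exists c; split; [exact Hc|].
  rewrite clamp_nonneg in E; lra.
Qed.

Lemma half_line_decreasing (f df : R -> R) (a b : R) :
  (forall x, 0 <= x -> D_in f df (Rle 0) x) ->
  (forall x, 0 <= x -> df x < 0) ->
  0 <= a -> a < b -> f b < f a.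
Proof.
intros Hf Hneg Ha Hab.
destruct (half_line_mvt f df a b Hf) as [c [Hc E]]; try lra.
rewrite Rmin_left, Rmax_right in Hc by lra.
specialize (Hneg c ltac:(lra)); nra.
Qed.

Lemma half_line_increasing (f df : R -> R) (a b : R) :
  (forall x, 0 <= x -> D_in f df (Rle 0) x) ->
  (forall x, 0 <= x -> 0 < df x) ->
  0 <= a -> a < b -> f a < f b.
Proof.
intros Hf Hpos Ha Hab.
destruct (half_line_mvt f df a b Hf) as [c [Hc E]]; try lra.
rewrite Rmin_left, Rmax_right in Hc by lra.
specialize (Hpos c ltac:(lra)); nra.
Qed.

(** * Convexity and first-order conditions on the half-line *)

Lemma convex_above_tangent (f df ddf : R -> R) (a b : R) :
  (forall x, 0 <= x -> D_in f df (Rle 0) x) ->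
  (forall x, 0 <= x -> D_in df ddf (Rle 0) x) ->
  (forall x, 0 <= x -> 0 < ddf x) ->
  0 <= a -> 0 <= b -> f a + df a * (b - a) <= f b.
Proof.
intros Hf Hdf Hpos Ha Hb.
destruct (half_line_mvt f df a b Hf) as [c [Hc E]]; try lra.
destruct (Rle_lt_dec a b) as [Hab|Hab].
- rewrite Rmin_left, Rmax_right in Hc by lra.
  destruct (Req_dec a c) as [<-|Hac]; [lra|].
  assert (df a < df c) by (apply (half_line_increasing df ddf); auto; lra).
  nra.
- rewrite Rmin_right, Rmax_left in Hc by lra.
  destruct (Req_dec a c) as [<-|Hac]; [lra|].
  assert (df c < df a) by (apply (half_line_increasing df ddf); auto; lra).
  nra.
Qed.

(** The tangent inequality at [a], scaled by [c], bounds the cost difference below by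
    [(1 + c * df a) * (b - a)]. Stating optimality as a variational inequality covers stationary
    points, the boundary 0 and one-sided comparisons at the kink alike. *)
Lemma convex_cost_min (f df ddf : R -> R) (c a b : R) :
  (forall x, 0 <= x -> D_in f df (Rle 0) x) ->
  (forall x, 0 <= x -> D_in df ddf (Rle 0) x) ->
  (forall x, 0 <= x -> 0 < ddf x) ->
  0 < c -> 0 <= a -> 0 <= b -> 0 <= (1 + c * df a) * (b - a) ->
  c * f a + a <= c * f b + b.
Proof.
intros Hf Hdf Hpos Hc Ha Hb Hfoc.
pose proof (convex_above_tangent f df ddf a b Hf Hdf Hpos Ha Hb).
nra.
Qed.

(** Turns the absence of a stationary point into a sign at 0, by intermediate values of [df] between
    0 and [b]. *)
Lemma preimage_deriv_or_above (df ddf : R -> R) (y b : R) :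
  (forall x, 0 <= x -> D_in df ddf (Rle 0) x) ->
  0 <= b -> y <= df b ->
  (exists x, preimage df y x) \/ y < df 0.
Proof.
intros Hdf Hb Hyb.
destruct (Rlt_le_dec y (df 0)) as [H0|H0]; [right; exact H0|left].
destruct (half_line_ivt df ddf 0 b y Hdf) as [c [Hc E]]; try lra.
- rewrite Rmin_left, Rmax_right; lra.
- rewrite Rmin_left, Rmax_right in Hc by lra.
  exists c; split; lra.
Qed.

Lemma pos_convex_slope_ge (f df ddf : R -> R) (c : R) :
  (forall x, 0 <= x -> D_in f df (Rle 0) x) ->
  (forall x, 0 <= x -> D_in df ddf (Rle 0) x) ->
  (forall x, 0 <= x -> 0 < f x) ->
  (forall x, 0 <= x -> 0 < ddf x) ->
  0 < c -> exists b, 0 <= b /\ - (1 / c) <= df b.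
Proof.
intros Hf Hdf Hpos Hddf Hc.
assert (H0 : 0 < f 0) by (apply Hpos; lra).
assert (Hb : 0 <= c * f 0) by nra.
(* A line of slope [- (1 / c)] starting at height [f 0] reaches zero here. The tangent at this
   point, evaluated at 0, lies below [f 0], and [f] is still positive at the point, which forces the
   slope up. *)
exists (c * f 0); split; [exact Hb|].
pose proof (convex_above_tangent f df ddf (c * f 0) 0 Hf Hdf Hddf Hb (Rle_refl 0)).
pose proof (Hpos _ Hb).
assert (K : 0 < f 0 * (1 + c * df (c * f 0))) by nra.
assert (K' : 0 < 1 + c * df (c * f 0)) by nra.
replace (df (c * f 0)) with ((1 + c * df (c * f 0)) / c - 1 / c) by (field; lra).
pose proof (Rdiv_lt_0_compat _ _ K' Hc); lra.
Qed.

Lemma mul_neg_inv (c : R) : 0 < c -> c * - (1 / c) = -1.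
Proof. intros; field; lra. Qed.

(** * Sign of the data loss and feasible payments *)

Lemma data_loss_nonneg_iff (B : R -> R) (L Vb I : R) :
  0 < B I -> (0 <= data_loss B L Vb I <-> L >= - Vb / B I).
Proof.
intros HB; unfold data_loss.
assert (E : Vb + B I * L = B I * (L - - Vb / B I)) by (field; lra).
rewrite E; split; intros; nra.
Qed.

Lemma data_loss_nonpos_iff (B : R -> R) (L Vb I : R) :
  0 < B I -> (data_loss B L Vb I <= 0 <-> - Vb / B I >= L).
Proof.
intros HB; unfold data_loss.
assert (E : Vb + B I * L = B I * (L - - Vb / B I)) by (field; lra).
rewrite E; split; intros; nra.
Qed.

Lemma feasible_payment_bounds (B : R -> R) (L alpha Vb I p1 p0 : R) :
  feasible B L alpha Vb I p1 p0 -> 0 <= I /\ 0 <= p1 /\ data_loss B L Vb I <= p1.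
Proof. unfold feasible, utility_high; lra. Qed.

Lemma feasible_nonneg_loss (B : R -> R) (L alpha Vb I : R) :
  0 < alpha < 1 -> 0 <= I -> 0 <= data_loss B L Vb I ->
  feasible B L alpha Vb I (data_loss B L Vb I) 0.
Proof. unfold feasible, utility_high, utility_low; intros; repeat split; nra. Qed.

(** With no payments, the low level retains only the fraction [alpha] of the nonnegative benefit
    [- data_loss]. *)
Lemma feasible_nonpos_loss (B : R -> R) (L alpha Vb I : R) :
  0 < alpha < 1 -> 0 <= I -> data_loss B L Vb I <= 0 ->
  feasible B L alpha Vb I 0 0.
Proof. unfold feasible, utility_high, utility_low; intros; repeat split; nra. Qed.

(** * Sufficient conditions for optimality *)

Lemma optimal_nonneg_loss (k : nat) (B dB ddB : R -> R) (F L Sc alpha Vb : R)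
    (U : nat -> nat -> R) (I : R) :
  (forall x, 0 <= x -> D_in B dB (Rle 0) x) ->
  (forall x, 0 <= x -> D_in dB ddB (Rle 0) x) ->
  (forall x, 0 <= x -> 0 < ddB x) ->
  0 < F + L * INR k -> 0 < alpha < 1 -> 0 <= I -> 0 <= data_loss B L Vb I ->
  (forall J, 0 <= J -> 0 <= (1 + (F + L * INR k) * dB I) * (J - I)) ->
  optimal k B F L Sc alpha Vb U I (Vb + B I * L) 0.
Proof.
intros HB HdB HddB HF1 Ha HI Hloss Hfoc.
split; [apply feasible_nonneg_loss; auto|].
intros J q1 q0 Hq; apply feasible_payment_bounds in Hq.
destruct Hq as (HJ & Hq0 & Hq1); unfold profit; unfold data_loss in *.
(* A competitor pays at least its data loss, hence bears at least the larger-slope cost at [J]; the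
   candidate attains that cost at [I]. *)
pose proof (convex_cost_min B dB ddB _ I J HB HdB HddB HF1 HI HJ (Hfoc J HJ)).
pose proof (pos_INR k); nra.
Qed.

Lemma optimal_nonpos_loss (k : nat) (B dB ddB : R -> R) (F L Sc alpha Vb : R)
    (U : nat -> nat -> R) (I : R) :
  (forall x, 0 <= x -> D_in B dB (Rle 0) x) ->
  (forall x, 0 <= x -> D_in dB ddB (Rle 0) x) ->
  (forall x, 0 <= x -> 0 < ddB x) ->
  0 < F -> 0 < alpha < 1 -> 0 <= I -> data_loss B L Vb I <= 0 ->
  (forall J, 0 <= J -> 0 <= (1 + F * dB I) * (J - I)) ->
  optimal k B F L Sc alpha Vb U I 0 0.
Proof.
intros HB HdB HddB HF Ha HI Hloss Hfoc.
split; [apply feasible_nonpos_loss; auto|].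
intros J q1 q0 Hq; apply feasible_payment_bounds in Hq.
destruct Hq as (HJ & Hq0 & Hq1); unfold profit.
pose proof (convex_cost_min B dB ddB _ I J HB HdB HddB HF HI HJ (Hfoc J HJ)).
pose proof (pos_INR k); nra.
Qed.

Lemma optimal_zero_loss (k : nat) (B dB ddB : R -> R) (F L Sc alpha Vb : R)
    (U : nat -> nat -> R) (I : R) :
  (forall x, 0 <= x -> D_in B dB (Rle 0) x) ->
  (forall x, 0 <= x -> D_in dB ddB (Rle 0) x) ->
  (forall x, 0 <= x -> 0 < ddB x) ->
  0 < F -> 0 < F + L * INR k -> 0 < alpha < 1 ->
  0 <= I -> data_loss B L Vb I = 0 ->
  (F + L * INR k) * dB I <= -1 -> -1 <= F * dB I ->
  optimal k B F L Sc alpha Vb U I 0 0.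
Proof.
intros HB HdB HddB HF HF1 Ha HI Hloss Hleft Hright.
split; [apply feasible_nonpos_loss; auto; lra|].
intros J q1 q0 Hq; apply feasible_payment_bounds in Hq.
destruct Hq as (HJ & Hq0 & Hq1); unfold profit; unfold data_loss in *.
pose proof (pos_INR k).
(* Both costs agree at [I]. To the left the larger-slope cost bounds the competitor, through
   [q1 >= data_loss]; to the right the other cost does, through [q1 >= 0]. *)
destruct (Rle_lt_dec J I) as [HJI|HJI].
- assert (Hfoc : 0 <= (1 + (F + L * INR k) * dB I) * (J - I)) by nra.
  pose proof (convex_cost_min B dB ddB _ I J HB HdB HddB HF1 HI HJ Hfoc).
  nra.
- assert (Hfoc : 0 <= (1 + F * dB I) * (J - I)) by nra.
  pose proof (convex_cost_min B dB ddB _ I J HB HdB HddB HF HI HJ Hfoc).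
  nra.
Qed.

(** The left end [a] stands for [I3], or for 0 when [I3] does not exist. The data loss changes sign
    between [a] and [I1], so the kink lies between them. *)
Lemma optimal_at_kink (k : nat) (B dB ddB : R -> R) (F L Sc alpha Vb : R)
    (U : nat -> nat -> R) (a I1 : R) :
  (forall x, 0 <= x -> D_in B dB (Rle 0) x) ->
  (forall x, 0 <= x -> D_in dB ddB (Rle 0) x) ->
  (forall x, 0 <= x -> dB x < 0) ->
  (forall x, 0 <= x -> 0 < ddB x) ->
  0 < F -> 0 < L -> 0 < F + L * INR k -> 0 < alpha < 1 ->
  0 <= a -> 0 <= I1 -> a <= I1 ->
  0 <= data_loss B L Vb a -> data_loss B L Vb I1 <= 0 ->
  -1 <= F * dB a -> (F + L * INR k) * dB I1 = -1 ->
  exists I2, unique (preimage B (- Vb / L)) I2 /\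
    optimal k B F L Sc alpha Vb U I2 0 0.
Proof.
intros HB HdB Hneg HddB HF HL HF1 Ha Ha0 HI1 HaI1 Hla Hl1 Hfa Hf1.
assert (Edl : forall x, data_loss B L Vb x = (B x - - Vb / L) * L)
  by (intros; unfold data_loss; field; lra).
rewrite Edl in Hla, Hl1.
assert (Ba : - Vb / L <= B a) by nra.
assert (B1 : B I1 <= - Vb / L) by nra.
destruct (half_line_ivt B dB a I1 (- Vb / L) HB) as [I2 [HI2 E2]]; auto.
{ rewrite Rmin_right, Rmax_left; lra. }
rewrite Rmin_left, Rmax_right in HI2 by lra.
(* Monotonicity of [dB] carries the slope bounds at [a] and [I1] over to the kink. *)
assert (Hmono : forall x y, 0 <= x -> x <= y -> dB x <= dB y).
{ intros x y Hx [Hxy| <-]; [|apply Rle_refl].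
  left; apply (half_line_increasing dB ddB); auto. }
exists I2; split.
- split; [split; [lra|exact E2]|].
  intros x [Hx Ex].
  destruct (Rtotal_order I2 x) as [Hlt|[Heq|Hgt]]; [|exact Heq|].
  + pose proof (half_line_decreasing B dB I2 x HB Hneg ltac:(lra) Hlt); lra.
  + pose proof (half_line_decreasing B dB x I2 HB Hneg Hx Hgt); lra.
- apply (optimal_zero_loss k B dB ddB); auto; try lra.
  + rewrite Edl, E2; ring.
  + pose proof (Hmono I2 I1 ltac:(lra) ltac:(lra)); nra.
  + pose proof (Hmono a I2 ltac:(lra) ltac:(lra)); nra.
Qed.

Theorem mainTheorem5
  (k : nat) (B dB ddB : R -> R) (F L Sc alpha V W Vb : R)
  (U : nat -> nat -> R)
  (hk : (1 <= k)%nat)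
  (hdB : forall x : R, 0 <= x -> D_in B dB (Rle 0) x)
  (hddB : forall x : R, 0 <= x -> D_in dB ddB (Rle 0) x)
  (hB_pos : forall x : R, 0 <= x -> 0 < B x)
  (hdB_neg : forall x : R, 0 <= x -> dB x < 0)
  (hddB_pos : forall x : R, 0 <= x -> 0 < ddB x)
  (hB_lim : is_lim B p_infty 0)
  (hF : 0 < F) (hL : 0 < L)
  (halpha : 0 < alpha < 1)
  (hVb : Vb = V - W)
  (hVb_le0 : Vb <= 0) :
  (forall I1 I3 : R,
     preimage dB (- (1 / (F + L * INR k))) I1 ->
     preimage dB (- (1 / F)) I3 ->
     (L >= - Vb / B I1 ->
        optimal k B F L Sc alpha Vb U I1 (Vb + B I1 * L) 0) /\
     (- Vb / B I1 >= L /\ L >= - Vb / B I3 ->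
        exists I2 : R, unique (preimage B (- Vb / L)) I2 /\
          optimal k B F L Sc alpha Vb U I2 0 0) /\
     (- Vb / B I3 >= L ->
        optimal k B F L Sc alpha Vb U I3 0 0)) /\
  (forall I1 : R,
     preimage dB (- (1 / (F + L * INR k))) I1 ->
     ~ (exists I3 : R, preimage dB (- (1 / F)) I3) ->
     (L >= - Vb / B I1 ->
        optimal k B F L Sc alpha Vb U I1 (Vb + B I1 * L) 0) /\
     (- Vb / B I1 >= L /\ L >= - Vb / B 0 ->
        exists I2 : R, unique (preimage B (- Vb / L)) I2 /\
          optimal k B F L Sc alpha Vb U I2 0 0) /\
     (- Vb / B 0 >= L ->
        optimal k B F L Sc alpha Vb U 0 0 0)) /\
  (~ (exists I1 : R, preimage dB (- (1 / (F + L * INR k))) I1) ->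
   ~ (exists I3 : R, preimage dB (- (1 / F)) I3) ->
     (L >= - Vb / B 0 ->
        optimal k B F L Sc alpha Vb U 0 (Vb + B 0 * L) 0) /\
     (- Vb / B 0 >= L ->
        optimal k B F L Sc alpha Vb U 0 0 0)).
Proof.
assert (Hk : 0 < INR k) by (apply lt_0_INR; exact hk).
assert (HF1 : 0 < F + L * INR k) by nra.
assert (Hslopes : - (1 / F) < - (1 / (F + L * INR k))).
{ apply Ropp_lt_contravar; unfold Rdiv; rewrite !Rmult_1_l.
  apply Rinv_lt_contravar; nra. }
pose proof (mul_neg_inv F hF) as EF.
pose proof (mul_neg_inv _ HF1) as EF1.
(* A cost increasing at 0 satisfies the variational inequality there, since [J - 0] is
   nonnegative. *)
assert (Hzero : forall c, 0 < c -> - (1 / c) < dB 0 ->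
          forall J, 0 <= J -> 0 <= (1 + c * dB 0) * (J - 0)).
{ intros c Hc Hd J HJ; pose proof (mul_neg_inv c Hc).
  apply Rmult_le_pos; nra. }
assert (Hstat : forall c I, 0 < c -> dB I = - (1 / c) ->
          forall J, 0 <= J -> 0 <= (1 + c * dB I) * (J - I)).
{ intros c I Hc -> J _; rewrite (mul_neg_inv c Hc); lra. }
split; [|split].
- intros I1 I3 [HI1 E1] [HI3 E3].
  assert (HI31 : I3 <= I1).
  { destruct (Rle_lt_dec I3 I1) as [H|H]; [exact H|].
    pose proof (half_line_increasing dB ddB I1 I3 hddB hddB_pos HI1 H); lra. }
  split; [|split].
  + intros HLge; apply (optimal_nonneg_loss k B dB ddB); auto.
    apply data_loss_nonneg_iff; auto.
  + intros [HLle HLge]; apply (optimal_at_kink k B dB ddB) with I3 I1; auto.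
    * apply data_loss_nonneg_iff; auto.
    * apply data_loss_nonpos_iff; auto.
    * rewrite E3; lra.
    * rewrite E1; lra.
  + intros HLle; apply (optimal_nonpos_loss k B dB ddB); auto.
    apply data_loss_nonpos_iff; auto.
- intros I1 [HI1 E1] Hno3.
  (* At [I1] the slope already exceeds [- (1 / F)], so without [I3] it must exceed it from 0 on. *)
  assert (Hd0 : - (1 / F) < dB 0).
  { destruct (preimage_deriv_or_above dB ddB (- (1 / F)) I1) as [H|H]; auto; try lra.
    contradiction. }
  pose proof (Rle_refl 0) as H00.
  split; [|split].
  + intros HLge; apply (optimal_nonneg_loss k B dB ddB); auto.
    apply data_loss_nonneg_iff; auto.
  + intros [HLle HLge]; apply (optimal_at_kink k B dB ddB) with 0 I1; auto.
    * apply data_loss_nonneg_iff; auto.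
    * apply data_loss_nonpos_iff; auto.
    * nra.
    * rewrite E1; lra.
  + intros HLle; apply (optimal_nonpos_loss k B dB ddB); auto.
    apply data_loss_nonpos_iff; auto.
- intros Hno1 _.
  (* With no stationary point at hand, positivity of [B] supplies a point of large enough slope. *)
  destruct (pos_convex_slope_ge B dB ddB _ hdB hddB hB_pos hddB_pos HF1)
    as [b [Hb Hdb]].
  assert (Hd0 : - (1 / (F + L * INR k)) < dB 0).
  { destruct (preimage_deriv_or_above dB ddB _ b hddB Hb Hdb) as [H|H]; auto.
    contradiction. }
  pose proof (Rle_refl 0) as H00.
  split.
  + intros HLge; apply (optimal_nonneg_loss k B dB ddB); auto.
    apply data_loss_nonneg_iff; auto.
  + intros HLle; apply (optimal_nonpos_loss k B dB ddB); auto.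
    * apply data_loss_nonpos_iff; auto.
    (* By [Hslopes], the bound [Hd0] also places [dB 0] above [- (1 / F)]. *)
    * apply Hzero; auto; lra.
Qed.
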